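(* Let $X,Y\in\mathfrak{A}$ be monotonically independent over $\mathfrak{B}$ with respect to $\Phi$ (in this order: the index of $X$ is smaller than the index of $Y$). Then $$\mathfrak{H}_{X+Y}=\mathfrak{H}_X\circ\mathfrak{H}_Y,$$ where $\circ$ denotes formal composition of multilinear function series over $\mathfrak{B}$.
   Context: $\mathfrak{B}$ is an algebra (not necessarily unital, not necessarily a $*$-algebra) and $\mathfrak{A}$ is a $\mathfrak{B}$-algebra: an algebra such that either $\mathfrak{B}$ is a subalgebra of $\mathfrak{A}$, or there is an algebra $\widetilde{\mathfrak{A}}$ containing $\mathfrak{A}$ and $\mathfrak{B}$ as subalgebras which is their direct sum as a vector space, with $\mathfrak{A}$ stable under left and right multiplication by $\mathfrak{B}$. $\Phi:\mathfrak{A}\to\mathfrak{B}$ is $\mathfrak{B}$-linear, i.e. linear with $\Phi(b_1xb_2)=b_1\Phi(x)b_2$ for $x\in\mathfrak{A}$, $b_1,b_2\in\mathfrak{B}$, and $\Phi(b)=b$ for $b\in\mathfrak{B}$ in case $\mathfrak{B}\subseteq\mathfrak{A}$. Multilinear function series. Let $\widetilde{\mathfrak{B}}$ be $\mathfrak{B}$ if $\mathfrak{B}$ is unital and its unitization otherwise. A multilinear function series over $\mathfrak{B}$ is a sequence $\omega=(\omega_0,\omega_1,\dots)$ with $\omega_0\in\widetilde{\mathfrak{B}}$ and $\omega_n:\mathfrak{B}^n\to\mathfrak{B}$ multilinear for $n\ge1$. If $G_0=0$, the formal composition $F\circ G$ is given by $(F\circ G)_0=F_0$ and, for $n\ge1$,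 $$(F\circ G)_n(b_1,\dots,b_n)=\sum_{k=1}^n\ \sum_{\substack{p_1,\dots,p_k\ge1\\ p_1+\dots+p_k=n}}F_k\big(G_{p_1}(b_1,\dots,b_{p_1}),\dots,G_{p_k}(b_{q_k+1},\dots,b_{q_k+p_k})\big),$$ where $q_j=p_1+\dots+p_{j-1}$. For $X\in\mathfrak{A}$, $\mathfrak{H}_X=(\mathfrak{H}_{X,0},\mathfrak{H}_{X,1},\dots)$ is the multilinear function series with $\mathfrak{H}_{X,0}=0$, $\mathfrak{H}_{X,1}(b)=b$, and $\mathfrak{H}_{X,n}(b_1,\dots,b_n)=\Phi(b_1Xb_2X\cdots b_{n-1}Xb_n)$ for $n\ge2$. Monotonic independence. A family $\{\mathfrak{A}_j\}_{j\in I}$ of subalgebras of $\mathfrak{A}$ indexed by a totally ordered set $I$ is monotonically independent over $\mathfrak{B}$ (with respect to $\Phi$) if: (a) for all $i<j>k$ in $I$, all $X_i\in\mathfrak{A}_i$, $X_j\in\mathfrak{A}_j$, $X_k\in\mathfrak{A}_k$ and all $A,B\in\mathfrak{A}$ (either of $A,B$ may also be absent), $\Phi(AX_iX_jX_kB)=\Phi(AX_i\Phi(X_j)X_kB)$; (b) for all $i_m>\dots>i_1<k_1<\dots<k_n$ in $I$ and all $X_l\in\mathfrak{A}_l$: $\Phi(X_{i_m}\cdots X_{i_1})=\Phi(X_{i_m})\cdots\Phi(X_{i_1})$, $\Phi(X_{k_1}\cdots X_{k_n})=\Phi(X_{k_1})\cdots\Phi(X_{k_n})$, and $\Phi(X_{i_m}\cdots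 X_{i_1}X_{k_1}\cdots X_{k_n})=\Phi(X_{i_m})\cdots\Phi(X_{i_1})\Phi(X_{k_1})\cdots\Phi(X_{k_n})$. Elements $\{X_j\}_{j\in I}$ of $\mathfrak{A}$ are monotonically independent over $\mathfrak{B}$ if the subalgebras they generate together with $\mathfrak{B}$ are; here the subalgebra generated by $X_j$ and $\mathfrak{B}$ means the linear span of all words $b_0X_jb_1X_j\cdots X_jb_n$ with $n\ge1$ and each $b_l$ in $\mathfrak{B}$ or absent (elements of $\mathfrak{B}$ alone are not included). *)

(* Defs.v *)
From HB Require Import structures.
From mathcomp Require Import all_boot all_order all_algebra.
From mathcomp Require Import boolp.
Set Implicit Arguments.
Unset Strict Implicit.
Unset Printing Implicit Defensive.
Import Order.TTheory GRing.Theory.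
Local Open Scope ring_scope.

(* Algebras over a field [K], not necessarily unital.  Their product is the
   [%g] product of MathComp's semigroups, since the [%R] product presupposes
   a unit. *)
HB.mixin Record Lmodule_Semigroup_isNuAlgebra (K : fieldType) (A : Type)
    of GRing.Lmodule K A & Semigroup A := {
  nu_mulDl : forall x y z : A, ((x + y) * z)%g = (x * z)%g + (y * z)%g;
  nu_mulDr : forall x y z : A, (x * (y + z))%g = (x * y)%g + (x * z)%g;
  nu_scaleAl : forall (c : K) (x y : A), ((c *: x) * y)%g = c *: (x * y)%g;
  nu_scaleAr : forall (c : K) (x y : A), (x * (c *: y))%g = c *: (x * y)%g
}.

#[short(type="nuAlgType")]
HB.structure Definition NuAlgebra (K : fieldType) :=
  {A of GRing.Lmodule K A & Semigroup A & Lmodule_Semigroup_isNuAlgebra K A}.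

Section Unitization.
Variables (K : fieldType) (B : nuAlgType K).

Definition unitization : Type := (K^o * B)%type.

HB.instance Definition _ := GRing.Lmodule.copy unitization (K^o * B)%type.

Definition unitization_mul (x y : unitization) : unitization :=
  ((x.1 : K) * y.1, (x.1 : K) *: y.2 + (y.1 : K) *: x.2 + (x.2 * y.2)%g).

Lemma unitization_mulA : associative unitization_mul.
Proof.
move=> [a x] [b y] [c z]; congr pair => /=; first by rewrite mulrA.
rewrite !nu_mulDl !nu_mulDr !nu_scaleAl !nu_scaleAr !scalerDr !scalerA mulgA.
rewrite [(c : K) * a]mulrC [(c : K) * b]mulrC -!addrA; do 2 congr (_ + _).
rewrite addrCA; congr (_ + _); rewrite addrCA [RHS]addrCA; congr (_ + _).
Qed.

HB.instance Definition _ := isSemigroup.Build unitization unitization_mulA.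

Lemma unitization_mulDl (x y z : unitization) :
  ((x + y) * z)%g = (x * z)%g + (y * z)%g.
Proof.
apply: injective_projections; [exact: (mulrDl (x.1 : K))|].
rewrite /= nu_mulDl scalerDl scalerDr [RHS]addrACA.
by congr (_ + _); apply: addrACA.
Qed.

Lemma unitization_mulDr (x y z : unitization) :
  (x * (y + z))%g = (x * y)%g + (x * z)%g.
Proof.
apply: injective_projections; [exact: (mulrDr (x.1 : K))|].
rewrite /= nu_mulDr scalerDl scalerDr [RHS]addrACA.
by congr (_ + _); apply: addrACA.
Qed.

Lemma unitization_scaleAl (c : K) (x y : unitization) :
  ((c *: x) * y)%g = c *: (x * y)%g.
Proof.
apply: injective_projections; [exact: esym (mulrA c _ _)|].
by rewrite /= !scalerDr nu_scaleAl !scalerA [(c : K) * y.1]mulrC.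
Qed.

Lemma unitization_scaleAr (c : K) (x y : unitization) :
  (x * (c *: y))%g = c *: (x * y)%g.
Proof.
apply: injective_projections; [exact: (mulrCA (x.1 : K) c)|].
by rewrite /= !scalerDr nu_scaleAr !scalerA [(c : K) * x.1]mulrC.
Qed.

HB.instance Definition _ := Lmodule_Semigroup_isNuAlgebra.Build K unitization
  unitization_mulDl unitization_mulDr unitization_scaleAl unitization_scaleAr.

End Unitization.

Definition unital (K : fieldType) (B : nuAlgType K) : Prop :=
  exists e : B, forall x : B, (e * x)%g = x /\ (x * e)%g = x.

Definition unitize (K : fieldType) (B : nuAlgType K) : nuAlgType K :=
  if pselect (unital B) then B else unitization B.

(* The two ways in which [A] can be a [B]-algebra; inclusions are rendered as
   injective algebra morphisms. *)
Variant balgebra (K : fieldType) (B A : nuAlgType K) : Type :=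
| BSubalgebra (iB : {linear B -> A})
    of injective iB & {morph iB : x y / (x * y)%g}
| BDirectSum (T : nuAlgType K) (iA : {linear A -> T}) (iB : {linear B -> T})
    of injective iA & {morph iA : x y / (x * y)%g}
    & injective iB & {morph iB : x y / (x * y)%g}
    & (forall t : T, exists! p : A * B, t = iA p.1 + iB p.2)
    & (forall b x, exists y, iA y = (iB b * iA x)%g)
    & (forall x b, exists y, iA y = (iA x * iB b)%g).

Section BAlgebra.
Variables (K : fieldType) (B A : nuAlgType K) (S : balgebra B A).

(* The products [b x] and [x b], for [b] in [B] and [x] in [A]. *)
Definition lact (b : B) (x : A) : A :=
  match S with
  | BSubalgebra iB _ _ => (iB b * x)%g
  | BDirectSum _ _ _ _ _ _ _ _ stl _ => projT1 (cid (stl b x))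
  end.

Definition ract (x : A) (b : B) : A :=
  match S with
  | BSubalgebra iB _ _ => (x * iB b)%g
  | BDirectSum _ _ _ _ _ _ _ _ _ str => projT1 (cid (str x b))
  end.

Lemma balgebra_ambient : exists (T : nuAlgType K) (iA : {linear A -> T})
    (iB : {linear B -> T}),
  [/\ injective iA, {morph iA : x y / (x * y)%g}, {morph iB : x y / (x * y)%g},
      forall b x, iA (lact b x) = (iB b * iA x)%g
    & forall x b, iA (ract x b) = (iA x * iB b)%g].
Proof.
rewrite /lact /ract; case: S => [iB _ iBM|T iA iB iAI iAM _ iBM _ stl str].
  by exists A, idfun, iB; split=> // x y.
exists T, iA, iB; split=> // [b x|x b].
  exact: projT2 (cid (stl b x)).
exact: projT2 (cid (str x b)).
Qed.

Lemma lact_linear b : linear (lact b).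
Proof.
have [T [iA [iB [iAI _ _ lE _]]]] := balgebra_ambient => c x y; apply: iAI.
by rewrite linearP !lE linearP nu_mulDr nu_scaleAr.
Qed.

Lemma lact_linearl x : linear (lact^~ x).
Proof.
have [T [iA [iB [iAI _ _ lE _]]]] := balgebra_ambient => c b b'; apply: iAI.
by rewrite linearP !lE linearP nu_mulDl nu_scaleAl.
Qed.

Lemma ract_linear b : linear (ract^~ b).
Proof.
have [T [iA [iB [iAI _ _ _ rE]]]] := balgebra_ambient => c x y; apply: iAI.
by rewrite linearP !rE linearP nu_mulDl nu_scaleAl.
Qed.

Lemma ract_linearr x : linear (ract x).
Proof.
have [T [iA [iB [iAI _ _ _ rE]]]] := balgebra_ambient => c b b'; apply: iAI.
by rewrite linearP !rE linearP nu_mulDr nu_scaleAr.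
Qed.

Lemma ractM x b b' : ract (ract x b) b' = ract x (b * b')%g.
Proof.
have [T [iA [iB [iAI iAM iBM lE rE]]]] := balgebra_ambient; apply: iAI.
by rewrite !rE iBM mulgA.
Qed.

Lemma mul_ract x y b : (x * ract y b)%g = ract (x * y)%g b.
Proof.
have [T [iA [iB [iAI iAM iBM lE rE]]]] := balgebra_ambient; apply: iAI.
by rewrite iAM !rE iAM mulgA.
Qed.

Lemma mul_lact x y b : (x * lact b y)%g = (ract x b * y)%g.
Proof.
have [T [iA [iB [iAI iAM iBM lE rE]]]] := balgebra_ambient; apply: iAI.
by rewrite !iAM rE lE mulgA.
Qed.

(* [b x] and [x b] where [b] may be absent. *)
Definition olact (b : option B) (x : A) : A := if b is Some c then lact c x else x.
Definition oract (x : A) (b : option B) : A := if b is Some c then ract x c else x.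

(* [word X b0 b1 [:: b2; ...; bn]] is b0 X b1 X b2 X ... X bn. *)
Definition word (X : A) (b0 b1 : option B) (s : seq (option B)) : A :=
  foldl (fun w b => oract (w * X)%g b) (oract (olact b0 X) b1) s.

Definition is_word (X w : A) : Prop := exists b0 b1 s, w = word X b0 b1 s.

Lemma is_word_oract X w b : is_word X w -> is_word X (oract w b).
Proof.
have oractM x c : exists d, oract (oract x c) b = oract x d.
  case: c b => [c|] [d|] /=; [exists (Some (c * d)%g)|exists (Some c)
    |exists (Some d)|exists None]; by rewrite //= ractM.
case=> b0 [b1 [s ->]]; case/lastP: s => [|s c].
  have [d E] := oractM (olact b0 X) b1; by exists b0, d, [::]; rewrite /word /= E.
have [d E] := oractM (word X b0 b1 s * X)%g c.
by exists b0, b1, (rcons s d); rewrite /word !foldl_rcons E.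
Qed.

Lemma is_word_mulX X w b : is_word X w -> is_word X (oract (w * X)%g b).
Proof.
by case=> b0 [b1 [s ->]]; exists b0, b1, (rcons s b); rewrite /word foldl_rcons.
Qed.

Lemma is_word_mul X v w : is_word X v -> is_word X w -> is_word X (v * w)%g.
Proof.
have mul_oract x y b : (x * oract y b)%g = oract (x * y)%g b.
  by case: b => //= b; rewrite mul_ract.
move=> vX [b0 [b1 [s ->]]]; elim/last_ind: s => [|s c IHs].
  rewrite /word /= mul_oract; have -> : (v * olact b0 X)%g = (oract v b0 * X)%g.
    by case: b0 => //= b; rewrite mul_lact.
  exact/is_word_mulX/is_word_oract.
by rewrite /word foldl_rcons mul_oract mulgA; apply: is_word_mulX.
Qed.

Definition gen_set (X a : A) : Prop :=
  exists s : seq (K * A), (forall p, p \in s -> is_word X p.2) /\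
                          a = \sum_(p <- s) p.1 *: p.2.

End BAlgebra.

Record subalgebra (K : fieldType) (A : nuAlgType K) := Subalgebra {
  subalg_set :> A -> Prop;
  subalg0 : subalg_set 0;
  subalgP : forall (c : K) x y,
    subalg_set x -> subalg_set y -> subalg_set (c *: x + y);
  subalgM : forall x y, subalg_set x -> subalg_set y -> subalg_set (x * y)%g
}.

Section Independence.
Variables (K : fieldType) (B A : nuAlgType K) (S : balgebra B A).

Lemma gen_set0 X : gen_set S X 0.
Proof. by exists [::]; split=> //; rewrite big_nil. Qed.

Lemma gen_setP X (c : K) x y :
  gen_set S X x -> gen_set S X y -> gen_set S X (c *: x + y).
Proof.
case=> s [sX ->] [t [tX ->]].
exists ([seq (c * p.1, p.2) | p <- s] ++ t); split.
  by move=> p; rewrite mem_cat => /orP[/mapP[q /sX qX ->]|/tX].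
rewrite big_cat big_map scaler_sumr; congr (_ + _).
by apply: eq_bigr => p _; rewrite scalerA.
Qed.

Lemma gen_setM X x y : gen_set S X x -> gen_set S X y -> gen_set S X (x * y)%g.
Proof.
case=> s [sX ->] [t [tX ->]].
exists [seq (p.1 * q.1, (p.2 * q.2)%g) | p <- s, q <- t]; split.
  move=> _ /allpairsP[[p q] /= [/sX pX /tX qX ->]]; exact: is_word_mul.
rewrite big_allpairs_dep /=.
have -> : ((\sum_(p <- s) p.1 *: p.2) * (\sum_(q <- t) q.1 *: q.2))%g =
    \sum_(p <- s) ((p.1 *: p.2) * (\sum_(q <- t) q.1 *: q.2))%g.
  apply: (big_morph (fun u : A => (u * _)%g)) => [u v|]; first exact: nu_mulDl.
  by rewrite -(scale0r (0 : A)) nu_scaleAl !scale0r.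
apply: eq_bigr => p _.
rewrite (big_morph (fun u : A => (_ * u)%g) (id1 := 0) (op1 := +%R)) => [|u v|].
- by apply: eq_bigr => q _; rewrite nu_scaleAl nu_scaleAr scalerA.
- exact: nu_mulDr.
by rewrite -(scale0r (0 : A)) nu_scaleAr !scale0r.
Qed.

(* The subalgebra generated by [X] and [B]; it need not contain [B]. *)
Definition gen (X : A) : subalgebra A :=
  Subalgebra (gen_set0 X) (@gen_setP X) (@gen_setM X).

Variable Phi : {linear A -> B}.

Definition B_linear : Prop :=
  (forall b1 b2 x, Phi (ract S (lact S b1 x) b2) = (b1 * Phi x * b2)%g) /\
  match S with
  | BSubalgebra iB _ _ => forall b, Phi (iB b) = b
  | BDirectSum _ _ _ _ _ _ _ _ _ _ => True
  end.

(* Product of a nonempty sequence; the value on [::] is never used. *)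
Definition sprod (G : nuAlgType K) (s : seq G) : G :=
  if s is x :: s' then foldl *%g x s' else 0.

(* [x y] and [y x] where [x] may be absent. *)
Definition olmul (x : option A) (y : A) : A := if x is Some z then (z * y)%g else y.
Definition ormul (y : A) (x : option A) : A := if x is Some z then (y * z)%g else y.

(* In the second clause [(i, x) :: p] lists the pairs (i_1, X_{i_1}), ...,
   (i_m, X_{i_m}), and [(k, y) :: q] lists (k_1, X_{k_1}), ..., (k_n, X_{k_n}). *)
Definition mon_indep d (I : orderType d) (F : I -> subalgebra A) : Prop :=
  (forall (i j k : I) (xi xj xk : A) (a b : option A),
     (i < j)%O -> (k < j)%O -> F i xi -> F j xj -> F k xk ->
     Phi (ormul (olmul a (xi * xj * xk)%g) b) =
     Phi (ormul (olmul a (ract S xi (Phi xj) * xk)%g) b)) /\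
  (forall (i k : I) (x y : A) (p q : seq (I * A)),
     path <%O i (unzip1 p) -> (i < k)%O -> path <%O k (unzip1 q) ->
     (forall z, z \in ((i, x) :: p) ++ ((k, y) :: q) -> F z.1 z.2) ->
     let s := rev (x :: unzip2 p) in
     let t := y :: unzip2 q in
     [/\ Phi (sprod s) = sprod (map Phi s),
         Phi (sprod t) = sprod (map Phi t)
       & Phi (sprod (s ++ t)) = sprod (map Phi (s ++ t))]).

Definition mon_indep_elements d (I : orderType d) (X : I -> A) : Prop :=
  mon_indep (fun j => gen (X j)).

End Independence.

Section Series.
Variables (K : fieldType) (B : nuAlgType K).

Definition upd n (b : {ffun 'I_n -> B}) (i : 'I_n) (u : B) : {ffun 'I_n -> B} :=
  [ffun j => if j == i then u else b j].

Definition multilinear n (f : {ffun 'I_n -> B} -> B) : Prop :=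
  forall b i, linear (fun u => f (upd b i u)).

(* [mfsS n] is the component of index n + 1. *)
Record mfs := Mfs {
  mfs0 : unitize B;
  mfsS : forall n, {ffun 'I_n.+1 -> B} -> B;
  mfsP : forall n, multilinear (@mfsS n)
}.

(* (b_(q+1), ..., b_(q+p)); the default value 0 is not reached if q + p <= n. *)
Definition block n (b : {ffun 'I_n -> B}) (q p : nat) : {ffun 'I_p -> B} :=
  [ffun l : 'I_p => oapp b 0 (insub (q + l)%N)].

Definition offset k n (r : {ffun 'I_k -> 'I_n}) (j : nat) : nat :=
  \sum_(l < k | (l < j)%N) (r l).+1.

(* The component of index n + 1 of the composition.  The number of parts is
   k + 1 and the parts are p_j = r j + 1, which keeps them positive. *)
Definition mfs_compS (F G : mfs) n (b : {ffun 'I_n.+1 -> B}) : B :=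
  \sum_(k < n.+1)
    \sum_(r : {ffun 'I_k.+1 -> 'I_n.+1} | (\sum_j (r j).+1 == n.+1)%N)
      mfsS F [ffun j : 'I_k.+1 => mfsS G (block b (offset r j) (r j).+1)].

Lemma multilinear_sum n (I : finType) (P : pred I)
    (f : I -> {ffun 'I_n -> B} -> B) :
  (forall i, P i -> multilinear (f i)) ->
  multilinear (fun b => \sum_(i | P i) f i b).
Proof.
move=> fP b i c u v; rewrite scaler_sumr -big_split.
by apply: eq_bigr => j Pj; rewrite fP.
Qed.

Lemma offsetS k n (r : {ffun 'I_k -> 'I_n}) (j : 'I_k) :
  offset r j.+1 = (offset r j + (r j).+1)%N.
Proof.
rewrite /offset (bigD1 j) ?ltnSn //= addnC; congr (_ + _)%N.
by apply: eq_bigl => l; rewrite ltnS [RHS]ltn_neqAle andbC.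
Qed.

Lemma offset_le k n (r : {ffun 'I_k -> 'I_n}) i j :
  (i <= j)%N -> (offset r i <= offset r j)%N.
Proof.
move=> ij; rewrite /offset [leqRHS](bigID (fun l : 'I_k => (l < i)%N)) /=.
apply: leq_trans (leq_addr _ _); rewrite leq_eqVlt; apply/orP; left; apply/eqP.
apply: eq_bigl => l; case: (ltnP l i) => // li; last by rewrite andbF.
by rewrite (leq_trans li ij).
Qed.

Lemma offset_find k n (r : {ffun 'I_k -> 'I_n}) i :
  (i < \sum_j (r j).+1)%N ->
  exists j : 'I_k, (offset r j <= i < offset r j.+1)%N.
Proof.
have -> : (\sum_j (r j).+1)%N = offset r k.
  by apply: eq_bigl => l; rewrite ltn_ord.
have H t : (t <= k)%N -> (i < offset r t)%N ->
    exists j : 'I_k, (offset r j <= i < offset r j.+1)%N.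
  elim: t => [|t IHt] tk; first by rewrite /offset big1.
  case: (ltnP i (offset r t)) => [it _|ti it1]; first exact: IHt (ltnW tk) it.
  by exists (Ordinal tk); rewrite ti.
exact: H.
Qed.

Lemma block_upd n (b : {ffun 'I_n -> B}) (i : 'I_n) u q p (l : 'I_p) :
  (q + l = i)%N -> block (upd b i u) q p = upd (block b q p) l u.
Proof.
move=> li; apply/ffunP => l'; rewrite !ffunE; case: eqP => [->|ne].
  by rewrite li valK /= ffunE eqxx.
case: insubP => //= m _ mE; rewrite ffunE; case: eqP => // mi; case: ne.
by apply/val_inj/eqP; rewrite -(eqn_add2l q) li -mE mi.
Qed.

Lemma block_upd_out n (b : {ffun 'I_n -> B}) (i : 'I_n) u q p :
  ~~ (q <= i < q + p)%N -> block (upd b i u) q p = block b q p.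
Proof.
move=> out; apply/ffunP => l'; rewrite !ffunE; case: insubP => //= m _ mE.
rewrite ffunE; case: eqP => // mi; case/negP: out.
by rewrite -mi mE leq_addr ltn_add2l ltn_ord.
Qed.

Lemma mfs_compP F G n : multilinear (@mfs_compS F G n).
Proof.
apply: multilinear_sum => k _; apply: multilinear_sum => r /eqP rE b i.
have [j /andP[ji ij]] : exists j : 'I_k.+1, (offset r j <= i < offset r j.+1)%N.
  by apply: offset_find; rewrite rE.
rewrite offsetS in ij.
have lP : (i - offset r j < (r j).+1)%N by rewrite ltn_subLR.
pose l := Ordinal lP.
have lE : (offset r j + l = i)%N by rewrite /= subnKC.
have E u : [ffun j' : 'I_k.+1 => mfsS G (block (upd b i u) (offset r j') (r j').+1)] =
    upd [ffun j' : 'I_k.+1 => mfsS G (block b (offset r j') (r j').+1)] j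
        (mfsS G (upd (block b (offset r j) (r j).+1) l u)).
  apply/ffunP => j'; rewrite !ffunE; case: eqP => [->|/eqP ne].
    by rewrite (block_upd _ _ lE).
  rewrite block_upd_out // -offsetS; apply/negP => /andP[j'i ij'].
  move: ne; rewrite neq_ltn => /orP[lt|lt].
    by have := leq_trans ij' (leq_trans (offset_le r lt) ji); rewrite ltnn.
  have := leq_trans (offset_le r lt) j'i; rewrite offsetS => le.
  by have := leq_trans ij le; rewrite ltnn.
by move=> c u v; rewrite !E (mfsP G) (mfsP F).
Qed.

(* Meaningful when the component of index 0 of [G] is 0. *)
Definition mfs_comp (F G : mfs) : mfs := Mfs (mfs0 F) (@mfs_compP F G).

End Series.

Section HSeries.
Variables (K : fieldType) (B A : nuAlgType K) (S : balgebra B A).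
Variables (Phi : {linear A -> B}) (X : A).

(* b1 X b2 X ... X bn, mapped by [Phi] when n >= 2; the value on [::] is never
   used. *)
Definition Hseq (s : seq B) : B :=
  match s with
  | [::] => 0
  | [:: b1] => b1
  | [:: b1, b2 & s'] => Phi (word S X (Some b1) (Some b2) (map some s'))
  end.

Lemma word_foldl_linear s :
  linear (foldl (fun w b => oract S (w * X)%g b) ^~ s : A -> A).
Proof.
elim/last_ind: s => [|s b IHs] c u v //.
rewrite !foldl_rcons IHs nu_mulDl nu_scaleAl.
by case: b => //= b; rewrite ract_linear.
Qed.

Lemma Hseq_linear s t : linear (fun u => Hseq (s ++ u :: t)).
Proof.
move=> c u v; case: s => [|b1 s] /=.
  case: t => //= b t.
  by rewrite /word /= lact_linearl ract_linear word_foldl_linear linearP.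
case: s => [|b2 s] /=.
  by rewrite /word /= ract_linearr word_foldl_linear linearP.
rewrite !map_cat /word !foldl_cat /= ract_linearr word_foldl_linear.
by rewrite linearP.
Qed.

Definition HS n (b : {ffun 'I_n.+1 -> B}) : B := Hseq (codom b).

Lemma codom_upd n (b : {ffun 'I_n -> B}) i u :
  codom (upd b i u) = take i (codom b) ++ u :: drop i.+1 (codom b).
Proof.
have sz : size (codom b) = n by rewrite size_codom card_ord.
transitivity (set_nth 0 (codom b) i u); last by rewrite set_nthE sz ltn_ord.
apply: (@eq_from_nth _ 0) => [|j].
  by rewrite size_set_nth sz size_codom card_ord (maxn_idPr (ltn_ord i)).
rewrite size_codom card_ord => jn; rewrite nth_set_nth /=.
have nthc (f : {ffun 'I_n -> B}) : nth 0 (codom f) j = f (Ordinal jn).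
  rewrite codomE (nth_map (Ordinal jn)) ?size_enum_ord //.
  by congr (f _); apply: val_inj; rewrite /= nth_enum_ord.
by rewrite !nthc ffunE.
Qed.

Lemma HP n : multilinear (@HS n).
Proof. by move=> b i c u v; rewrite /HS !codom_upd Hseq_linear. Qed.

Definition Hser : mfs B := Mfs 0 HP.

End HSeries.

(* Main.v *)
Require Import Defs.
From HB Require Import structures.
From mathcomp Require Import all_boot all_order all_algebra.
From mathcomp Require boolp.
Set Implicit Arguments.
Unset Strict Implicit.
Unset Printing Implicit Defensive.
Import Order.TTheory GRing.Theory.
Local Open Scope ring_scope.

(** Expand [b1 (X + Y) b2 ... (X + Y) bn] into words in the letters [X] and [Y],
    and cut each word at its letters [X].  The pieces are blocks
    [b Y b' Y ... Y b''], possibly reduced to a single [b], so the words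
    correspond to the compositions of [n], which also index the terms of
    [H_X o H_Y].  It remains to evaluate one word
    [Phi(w0 X w1 X ... X wk) = Phi(h0 X h1 X ... X hk)], where
    [hi = Phi(wi) = H_Y(wi)], or [hi = b] for a block reduced to [b].

    A block between two letters [X] is a local maximum of the indices, so
    condition (a) replaces it by its value ([Phi_inner_block]).  There remains
    [w0 x wk] with [x] a word in [X].  Its indices descend from [Y] to [X] and
    ascend to [Y], so condition (b) gives [Phi(w0) Phi(x) Phi(wk)], which is
    [Phi(h0 x hk)] by [B]-linearity ([Phi_outer_blocks]).

    The delicate case is that of an end block reduced to a scalar.
    [B]-linearity only says [Phi(b x c) = b Phi(x) c]; when [B] has no unit it
    does not give [Phi(x c) = Phi(x) c], so a scalar on one side only cannot be
    pulled out.  It does give [b Phi(x c) d = b Phi(x) c d], because both sides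
    are [Phi(b x c d)].  This weaker rule suffices: a block with at least one
    letter [Y] is [b y d] with scalars [b], [d] at its two ends; its outer scalar
    and the scalar block at the other end enclose the whole word, which allows
    the weaker rule to deal with the inner scalar. *)

(** * Compositions of a positive integer *)

Definition incr_head (c : seq nat) : seq nat :=
  if c is h :: t then h.+1 :: t else [::].

(** The compositions of [n + 1].  The recursion decides whether the first unit
    is a part of its own or is merged into the next part; for words this is the
    choice between [X] and [Y] for the first letter. *)
Fixpoint compositions (n : nat) : seq (seq nat) :=
  if n is m.+1 then
    map (cons 1%N) (compositions m) ++ map incr_head (compositions m)
  else [:: [:: 1%N]].

Lemma mem_compositions n c :
  (c \in compositions n) = all (leq 1) c && (sumn c == n.+1).
Proof.
elim: n c => [|n IHn] c.
  by rewrite inE; case: c => [|[|[|h]] [|[|h'] t]] //=;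
    rewrite ?add1n ?addSn ?eqSS andbF.
rewrite [compositions _]/= mem_cat; apply/orP/idP.
  case=> /mapP[d]; rewrite IHn => /andP[d_gt0 /eqP sumd] ->.
    by rewrite /= d_gt0 add1n sumd eqxx.
  case: d d_gt0 sumd => //= h t /andP[_ ->].
  by rewrite addSn => ->; rewrite eqxx.
case: c => [|[|[|h]] t] //= /andP[t_gt0]; rewrite ?add1n ?addSn !eqSS => sumt.
  by left; apply/mapP; exists t => //; rewrite IHn t_gt0.
right; apply/mapP; exists (h.+1 :: t) => //.
by rewrite IHn /= t_gt0 addSn eqSS.
Qed.

Lemma compositions_uniq n : uniq (compositions n).
Proof.
elim: n => //= n IHn; rewrite cat_uniq map_inj_uniq ?IHn => [|c d []] //=.
apply/andP; split.
  apply/hasPn => d /mapP[c]; rewrite mem_compositions => /andP[c_gt0 _] ->{d}.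
  by apply/mapP => -[d _]; case: c c_gt0 => // -[|h] t //= _ [].
rewrite map_inj_in_uniq // => c d.
by rewrite !mem_compositions; case: c d => [|? ?] [|? ?] //= _ _ [-> ->].
Qed.

Lemma reshape_compositions_nonnil (T : Type) n c (s : seq T) :
  c \in compositions n -> size s = n.+1 -> all (leq 1 \o size) (reshape c s).
Proof.
rewrite mem_compositions => /andP[c_gt0 /eqP sumc] sz.
by rewrite -(all_map size) -/(shape _) reshapeKl // sumc sz.
Qed.

Section CompositionSum.
Variables (V : nmodType) (n : nat) (f : seq nat -> V).

Let part k (r : {ffun 'I_k.+1 -> 'I_n.+1}) : seq nat :=
  [seq (r j).+1 | j <- enum 'I_k.+1].

Let nth_part k (r : {ffun 'I_k.+1 -> 'I_n.+1}) (j : 'I_k.+1) :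
  nth 0%N (part r) j = (r j).+1.
Proof. by rewrite (nth_map j) ?size_enum_ord // nth_ord_enum. Qed.

(** Both sides range over the same set of sequences, each listed once: reading
    [r] as the sequence of its shifted values is injective, even as [k] varies,
    since [k + 1] is the length of this sequence. *)
Lemma compositions_sumE :
  \sum_(k < n.+1)
    \sum_(r : {ffun 'I_k.+1 -> 'I_n.+1} | (\sum_j (r j).+1 == n.+1)%N)
      f [seq (r j).+1 | j <- enum 'I_k.+1] =
  \sum_(c <- compositions n) f c.
Proof.
pose t (k : 'I_n.+1) :=
  [seq r : {ffun 'I_k.+1 -> 'I_n.+1} <- enum {ffun 'I_k.+1 -> 'I_n.+1}
    | (\sum_j (r j).+1 == n.+1)%N].
have -> : \sum_(k < n.+1)
    \sum_(r : {ffun 'I_k.+1 -> 'I_n.+1} | (\sum_j (r j).+1 == n.+1)%N)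
      f (part r) =
    \sum_(c <- [seq part r | k <- enum 'I_n.+1, r <- t k]) f c.
  rewrite big_allpairs_dep [RHS]big_enum /=; apply: eq_bigr => k _.
  by rewrite /t big_filter big_enum_cond.
apply/perm_big/uniq_perm; last 1 first.
- move=> c; rewrite mem_compositions; apply/allpairsPdep/idP.
    case=> k [r [_]]; rewrite mem_filter => /andP[rE _] ->.
    apply/andP; split; first by apply/allP => _ /mapP[j _ ->].
    by rewrite sumnE big_map big_enum.
  case/andP => c_gt0 /eqP sumc.
  have c_le i : (nth 0%N c i <= n.+1)%N.
    case: (ltnP i (size c)) => ic; last by rewrite nth_default.
    rewrite -sumc -{2}(cat_take_drop i c) sumn_cat (drop_nth 0%N ic) /=.
    by rewrite addnCA leq_addr.
  have sz_c : (0 < size c <= n.+1)%N.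
    apply/andP; split; first by case: (c) sumc.
    rewrite -sumc; elim: (c) c_gt0 => //= h d IHd /andP[h_gt0 /IHd].
    by rewrite -add1n; apply: leq_add.
  have kP : ((size c).-1 < n.+1)%N by case/andP: sz_c; case: (size c).
  pose k := Ordinal kP.
  have kE : k.+1 = size c by rewrite /= prednK //; case/andP: sz_c.
  pose r : {ffun 'I_k.+1 -> 'I_n.+1} :=
    [ffun j : 'I_k.+1 => inord (nth 0%N c j).-1].
  have rE (j : 'I_k.+1) : (r j).+1 = nth 0%N c j.
    have jc : (j < size c)%N by rewrite -kE.
    have cj : (0 < nth 0%N c j)%N by apply: (allP c_gt0); apply: mem_nth.
    by rewrite ffunE inordK prednK.
  have cE : c = part r.
    apply: (@eq_from_nth _ 0%N) => [|i ic].
      by rewrite size_map size_enum_ord kE.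
    have ik : (i < k.+1)%N by rewrite kE.
    by rewrite -[i]/(val (Ordinal ik)) nth_part rE.
  exists k, r; split=> //; first by rewrite mem_enum.
  rewrite mem_filter mem_enum andbT; apply/eqP.
  by rewrite -[RHS]sumc [in RHS]cE sumnE big_map big_enum.
- apply: allpairs_uniq_dep => [|k _|]; rewrite ?enum_uniq //.
    by rewrite filter_uniq ?enum_uniq.
  move=> [k r] [k' r'] _ _ /= E.
  have kk' : k = k'.
    have /(congr1 size) : part r = part r' := E.
    by do 2![rewrite size_map size_enum_ord]; case=> /val_inj.
  case: _ / kk' r' E => r' E; congr existT; apply/ffunP => j; apply: val_inj.
  by apply: succn_inj; rewrite -!nth_part E.
- exact: compositions_uniq.
Qed.

End CompositionSum.

(** * Formal composition as a sum over compositions *)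

Lemma nth_codom_ffun (V : nmodType) n (b : {ffun 'I_n -> V}) (j : 'I_n) :
  nth 0 (codom b) j = b j.
Proof. by rewrite codomE (nth_map j) ?size_enum_ord // nth_ord_enum. Qed.

Section FormalComposition.
Variables (K : fieldType) (B : nuAlgType K).

Lemma mfs_eq (F G : mfs B) :
  mfs0 F = mfs0 G -> (forall n b, mfsS F (n := n) b = mfsS G b) -> F = G.
Proof.
case: F G => [F0 F1 FP] [G0 G1 GP] /= <- FG.
have E : F1 = G1.
  by apply: boolp.functional_extensionality_dep => n; apply: boolp.funext => b.
by case: _ / E GP {FG} => GP; congr Mfs; apply: boolp.Prop_irrelevance.
Qed.

Lemma offset_sumn k n (r : {ffun 'I_k -> 'I_n}) j : (j <= k)%N ->
  offset r j = sumn (take j [seq (r l).+1 | l <- enum 'I_k]).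
Proof.
elim: j => [|j IHj] jk; first by rewrite take0 /offset big1.
rewrite (take_nth 0%N); last by rewrite size_map size_enum_ord.
rewrite sumn_rcons -IHj ?(ltnW jk) //; have -> : j = Ordinal jk by [].
by rewrite offsetS (nth_map (Ordinal jk)) ?size_enum_ord // nth_ord_enum.
Qed.

Lemma codom_block n (b : {ffun 'I_n -> B}) q p : (q + p <= n)%N ->
  codom (block b q p) = take p (drop q (codom b)).
Proof.
move=> qpn; have sz : size (take p (drop q (codom b))) = p.
  rewrite size_takel // size_drop size_codom card_ord.
  by rewrite leq_subRL // (leq_trans (leq_addr _ _) qpn).
apply: (@eq_from_nth _ 0) => [|i]; rewrite size_codom card_ord ?sz // => ip.
have qin : (q + i < n)%N by apply: leq_trans qpn; rewrite ltn_add2l.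
rewrite nth_take // nth_drop -[i]/(val (Ordinal ip)) nth_codom_ffun ffunE /=.
by rewrite -[(q + i)%N]/(val (Ordinal qin)) valK nth_codom_ffun.
Qed.

Lemma codom_blocks n k (b : {ffun 'I_n -> B}) (r : {ffun 'I_k -> 'I_n}) :
  (\sum_j (r j).+1)%N = n ->
  [seq codom (block b (offset r j) (r j).+1) | j : 'I_k <- enum 'I_k] =
  reshape [seq (r j).+1 | j <- enum 'I_k] (codom b).
Proof.
move=> sumr; apply: (@eq_from_nth _ [::]) => [|i].
  by rewrite size_reshape !size_map.
rewrite size_map size_enum_ord => ik; have -> : i = Ordinal ik by [].
rewrite nth_reshape -offset_sumn ?(ltnW ik) //.
do 2![rewrite (nth_map (Ordinal ik)) ?size_enum_ord // nth_ord_enum].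
rewrite codom_block // -offsetS -[leqRHS]sumr /offset.
by rewrite [leqRHS](bigID (fun l : 'I_k => l < i.+1)%N) leq_addr.
Qed.

(** Cutting the arguments into blocks by offsets is [reshape]; so for series
    given by functions on lists, composition becomes a sum of [f] and [g] over
    lists, amenable to induction on the arguments. *)
Lemma mfs_compS_compositions (F G : mfs B) (f g : seq B -> B) n
    (b : {ffun 'I_n.+1 -> B}) :
  (forall m (a : {ffun 'I_m.+1 -> B}), mfsS F a = f (codom a)) ->
  (forall m (a : {ffun 'I_m.+1 -> B}), mfsS G a = g (codom a)) ->
  mfs_compS F G b =
  \sum_(c <- compositions n) f [seq g w | w <- reshape c (codom b)].
Proof.
move=> FE GE; rewrite -compositions_sumE; apply: eq_bigr => k _.
apply: eq_bigr => r /eqP sumr; rewrite FE -codom_blocks // -map_comp codomE.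
by congr (f _); apply: eq_map => j; rewrite ffunE GE.
Qed.

End FormalComposition.

(** * Alternating products *)

Section Interleave.
Variables (K : fieldType) (A : nuAlgType K) (T : Type) (f : A -> T -> A).

(** The product [u s1 Z s2 Z ... Z sk], where the [si] act on [A] from the right
    through [f].  They are scalars in [rword] and blocks in [rblocks]. *)
Definition interleave (Z u : A) (s : seq T) : A :=
  if s is a :: s' then foldl (fun v c => f (v * Z)%g c) (f u a) s' else u.

Lemma interleave_mull Z u v s :
  (forall x y a, f (x * y)%g a = (x * f y a)%g) ->
  interleave Z (u * v)%g s = (u * interleave Z v s)%g.
Proof.
move=> fM; case: s => [|a s] //=; rewrite fM.
by elim: s (f v a) => [|c s IHs] w //=; rewrite -(mulgA u w) (fM u) IHs.
Qed.

Lemma interleave_linear Z s :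
  (forall a, linear (f^~ a)) -> linear (interleave Z ^~ s).
Proof.
move=> f_lin c; case: s => [|a s] u v //=; rewrite f_lin.
elim: s (f u a) (f v a) => [|d s IHs] {}u {}v //=.
by rewrite nu_mulDl nu_scaleAl f_lin IHs.
Qed.

End Interleave.

Section Bimodule.
Variables (K : fieldType) (B A : nuAlgType K) (S : balgebra B A).
Implicit Types (b c : B) (x y : A).

Lemma lact_ract b x c : lact S b (ract S x c) = ract S (lact S b x) c.
Proof.
have [T [iA [iB [iAI _ _ lE rE]]]] := balgebra_ambient S; apply: iAI.
by rewrite lE !rE lE mulgA.
Qed.

Lemma lactM b c x : lact S b (lact S c x) = lact S (b * c)%g x.
Proof.
have [T [iA [iB [iAI _ iBM lE _]]]] := balgebra_ambient S; apply: iAI.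
by rewrite !lE iBM mulgA.
Qed.

Lemma lact_mul b x y : (lact S b x * y)%g = lact S b (x * y)%g.
Proof.
have [T [iA [iB [iAI iAM _ lE _]]]] := balgebra_ambient S; apply: iAI.
by rewrite lE !iAM lE mulgA.
Qed.

Lemma ract_mul x y b : ract S (x * y)%g b = (x * ract S y b)%g.
Proof. by rewrite mul_ract. Qed.

Lemma is_wordX X : is_word S X X.
Proof. by exists None, None, [::]. Qed.

Lemma is_word_ract X x b : is_word S X x -> is_word S X (ract S x b).
Proof. exact: (@is_word_oract _ _ _ S X x (Some b)). Qed.

Lemma is_word_lact X x b : is_word S X x -> is_word S X (lact S b x).
Proof.
case=> b0 [b1 [s ->]].
exists (Some (if b0 is Some c then (b * c)%g else b)), b1, s.
elim/last_ind: s => [|s c IHs].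
  by case: b0 b1 => [c|] [d|] //=; rewrite /word /= ?lact_ract ?lactM.
rewrite /word !foldl_rcons -!/(word _ _ _ _ _) -IHs lact_mul.
by case: c => //= c; rewrite lact_ract.
Qed.

Lemma gen_word X w : is_word S X w -> gen S X w.
Proof.
move=> wX; exists [:: (1, w)]; split; last by rewrite big_seq1 scale1r.
by move=> p; rewrite inE => /eqP ->.
Qed.

(** A block of [Z]'s as an operator from the right, which makes sense also when
    the block is a single scalar. *)
Definition rword (Z u : A) (s : seq B) : A := interleave (ract S) Z u s.

Lemma rword_mull Z u v s : rword Z (u * v)%g s = (u * rword Z v s)%g.
Proof. exact: interleave_mull ract_mul. Qed.

Lemma rword_linear Z s : linear (rword Z ^~ s).
Proof. exact/interleave_linear/ract_linear. Qed.

Lemma rwordD Z u v s : rword Z (u + v) s = rword Z u s + rword Z v s.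
Proof. by have := rword_linear Z s 1 u v; rewrite !scale1r. Qed.

Lemma lactD b x y : lact S b (x + y) = lact S b x + lact S b y.
Proof. by have := lact_linear S b 1 x y; rewrite !scale1r. Qed.

Lemma rword_cons2 Z u b c s :
  rword Z u [:: b, c & s] = (u * rword Z (lact S b Z) (c :: s))%g.
Proof. by rewrite -rword_mull mul_lact. Qed.

Lemma Hseq_rword (Phi : {linear A -> B}) Z b c s :
  Hseq S Phi Z [:: b, c & s] = Phi (rword Z (lact S b Z) (c :: s)).
Proof.
rewrite /= /word /=; congr (Phi _).
by elim: s (ract S _ _) => //= d s IHs u; rewrite IHs.
Qed.

(** A block with at least one letter [Z] has a scalar at each end, so that
    two-sided [B]-linearity applies to it. *)
Lemma rword_core Z b c s : exists y d,
  is_word S Z y /\ rword Z (lact S b Z) (c :: s) = ract S (lact S b y) d.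
Proof.
rewrite /rword /=; elim/last_ind: s => [|s d [y [e [yZ E]]]].
  by exists Z, c; split=> //; apply: is_wordX.
exists (ract S y e * Z)%g, d; split.
  by apply/is_word_mul/is_wordX/is_word_ract.
by rewrite foldl_rcons E -lact_ract lact_mul.
Qed.

Lemma is_word_rword Z b c s : is_word S Z (rword Z (lact S b Z) (c :: s)).
Proof.
by have [y [d [yZ ->]]] := rword_core Z b c s; apply/is_word_ract/is_word_lact.
Qed.

End Bimodule.

(** * Evaluating a product of blocks *)

Section Blocks.
Variables (K : fieldType) (B A : nuAlgType K) (S : balgebra B A).
Variables (Phi : {linear A -> B}) (X Y : A).

Let h (w : seq B) : B := Hseq S Phi Y w.

(** The product [w x] of a block of [Y]'s and [x]; a block reduced to one scalar
    need not be an element of [A] and has to act. *)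
Definition lblock (w : seq B) (x : A) : A :=
  match w with
  | [::] => x
  | [:: b] => lact S b x
  | b :: w' => (rword S Y (lact S b Y) w' * x)%g
  end.

Definition rblocks (u : A) (ws : seq (seq B)) : A :=
  interleave (rword S Y) X u ws.

Lemma lblock_ract w x b : lblock w (ract S x b) = ract S (lblock w x) b.
Proof. by case: w => [|b0 [|b1 w]] //=; rewrite ?lact_ract ?ract_mul. Qed.

Lemma lblock_mul w x y : lblock w (x * y)%g = (lblock w x * y)%g.
Proof. by case: w => [|b0 [|b1 w]] //=; rewrite ?lact_mul ?mulgA. Qed.

Lemma rblocks_mull u v ws : rblocks (u * v)%g ws = (u * rblocks v ws)%g.
Proof. by apply: interleave_mull => *; apply: rword_mull. Qed.

(** Condition (a) needs an element of the algebra generated by [X] to the right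
    of the local maximum.  A scalar following [X] is absorbed into this element;
    everything later is the optional context. *)
Lemma rblocks_startX w ws : (0 < size w)%N -> exists x a,
  is_word S X x /\ rblocks X (w :: ws) = ormul x a.
Proof.
case: w => // b w _; case: ws => [|w' ws].
  case: w => [|c w].
    by exists (ract S X b), None; split=> //; apply/is_word_ract/is_wordX.
  exists X, (Some (rword S Y (lact S b Y) (c :: w))).
  by split; [exact: is_wordX | exact: rword_cons2].
have -> : rblocks X [:: b :: w, w' & ws] =
    (rword S Y X (b :: w) * rblocks X (w' :: ws))%g.
  by rewrite -rblocks_mull.
case: w => [|c w].
  exists (ract S X b), (Some (rblocks X (w' :: ws))); split=> //.
  exact/is_word_ract/is_wordX.
exists X, (Some (rword S Y (lact S b Y) (c :: w) * rblocks X (w' :: ws)))%g.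
by split; [exact: is_wordX | rewrite rword_cons2 -mulgA].
Qed.

(** The letter following [b] is [X] or [Y]; [X] closes the block of [b], which
    prepends a part 1 to the composition, while [Y] extends it, which increases
    the first part. *)
Lemma rblocks_sum u b s :
  \sum_(c <- compositions (size s)) rblocks u (reshape c (b :: s)) =
  rword S (X + Y) u (b :: s).
Proof.
elim: s u b => [|b' s IHs] u b; first by rewrite big_seq1.
rewrite [compositions _]/= big_cat !big_map.
transitivity (rword S (X + Y) (ract S u b * X)%g (b' :: s) +
              rword S (X + Y) (ract S u b * Y)%g (b' :: s)).
  rewrite -!IHs; congr (_ + _); apply: eq_big_seq => c.
    by rewrite mem_compositions; case: c => [|[|m] t].
  by rewrite mem_compositions; case: c => [|[|m] t].
by rewrite -rwordD -nu_mulDr.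
Qed.

Hypothesis Phi_lin : B_linear S Phi.
Hypothesis XY_indep :
  mon_indep_elements S Phi (fun j : bool => if j then Y else X).

Lemma Phi_lract b x c : Phi (ract S (lact S b x) c) = (b * Phi x * c)%g.
Proof. exact: Phi_lin.1. Qed.

(** Both sides are [Phi(b x c d)]; dropping [b] would need one-sided
    linearity. *)
Lemma Phi_sandwich_ract b x c d :
  (b * Phi (ract S x c) * d)%g = (b * Phi x * (c * d))%g.
Proof. by rewrite -!Phi_lract lact_ract ractM. Qed.

Lemma Phi_sandwich_lact b x c d :
  (b * Phi (lact S c x) * d)%g = (b * c * Phi x * d)%g.
Proof. by rewrite -!Phi_lract lactM. Qed.

Lemma Phi_descent y x : is_word S Y y -> is_word S X x ->
  Phi (y * x)%g = (Phi y * Phi x)%g.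
Proof.
move=> yY xX; have [_ indep] := XY_indep.
(* Condition (b) speaks of a descending and an ascending part together; 0 fills
   the ascending one. *)
have [] := indep false true x 0 [:: (true, y)] [::]; rewrite //=.
move=> z; rewrite !inE => /or3P[] /eqP -> /=; last exact: gen_set0.
  exact: gen_word.
exact: gen_word.
Qed.

Lemma Phi_ascent x y : is_word S X x -> is_word S Y y ->
  Phi (x * y)%g = (Phi x * Phi y)%g.
Proof.
move=> xX yY; have [_ indep] := XY_indep.
have [] := indep false true x y [::] [::]; rewrite //=.
by move=> z; rewrite !inE => /orP[] /eqP -> /=; exact: gen_word.
Qed.

Lemma Phi_valley y x y' : is_word S Y y -> is_word S X x -> is_word S Y y' ->
  Phi (y * x * y')%g = (Phi y * Phi x * Phi y')%g.
Proof.
move=> yY xX y'Y; have [_ indep] := XY_indep.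
have [] := indep false true x y' [:: (true, y)] [::]; rewrite //=.
by move=> z; rewrite !inE => /or3P[] /eqP -> /=; exact: gen_word.
Qed.

(** Two scalar blocks are pulled out by linearity, and two blocks containing [Y]
    by condition (b).  In the mixed cases write the block with [Y] as [b y d]:
    its outer scalar and the scalar block enclose the word, its inner scalar
    moves next to [x], and after condition (b) has split the product the inner
    scalar leaves [Phi] by [Phi_sandwich_ract] or [Phi_sandwich_lact]. *)
Lemma Phi_outer_blocks w0 x w : is_word S X x ->
  (0 < size w0)%N -> (0 < size w)%N ->
  Phi (rword S Y (lblock w0 x) w) = (h w0 * Phi x * h w)%g.
Proof.
move=> xX; case: w0 w => [|b0 [|b1 w0]] // [|c0 [|c1 w]] // _ _.
- exact: Phi_lract.
- rewrite rword_cons2 /h Hseq_rword.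
  have [y [d [yY ->]]] := rword_core S Y c0 c1 w.
  rewrite mul_ract mul_lact /= -lact_ract lact_mul !Phi_lract.
  rewrite Phi_ascent //; last exact: is_word_ract.
  by rewrite (mulgA b0) -(mulgA (b0 * _)%g) Phi_sandwich_ract !mulgA.
- rewrite /h Hseq_rword /lblock.
  have [y [d [yY ->]]] := rword_core S Y b0 b1 w0.
  rewrite -[rword _ _ _ _]/(ract S _ c0) -mul_lact lact_mul !Phi_lract.
  rewrite Phi_descent //; last exact: is_word_lact.
  by rewrite !mulgA Phi_sandwich_lact.
rewrite rword_cons2 /h !Hseq_rword /lblock.
by apply: Phi_valley => //; apply: is_word_rword.
Qed.

(** Condition (a) with [z] as local maximum.  If the initial block contains [Y]
    it belongs to the left context; a scalar is absorbed by [x]. *)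
Lemma Phi_peak w0 x z y a : is_word S X x -> is_word S Y z -> is_word S X y ->
  Phi (lblock w0 x * z * ormul y a)%g =
  Phi (ract S (lblock w0 x) (Phi z) * ormul y a)%g.
Proof.
move=> xX zY yX.
have [a0 [x0 [x0X ->]]] :
    exists a0 x0, is_word S X x0 /\ lblock w0 x = olmul a0 x0.
  case: w0 => [|b [|c w]]; first by exists None, x.
    by exists None, (lact S b x); split=> //; apply: is_word_lact.
  by exists (Some (rword S Y (lact S b Y) (c :: w))), x.
have [indep _] := XY_indep.
have := indep false true false x0 z y a0 a isT isT
  (gen_word x0X) (gen_word zY) (gen_word yX).
by case: a0 a => [a0|] [a|] /=; rewrite ?ract_mul ?mulgA.
Qed.

Lemma Phi_inner_block w0 x w w' ws : is_word S X x ->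
  (0 < size w)%N -> (0 < size w')%N ->
  Phi (rblocks (rword S Y (lblock w0 x) w * X)%g (w' :: ws)) =
  Phi (rblocks (ract S (lblock w0 x) (h w) * X)%g (w' :: ws)).
Proof.
move=> xX; case: w => [|b [|c w]] // _ w'_gt0.
rewrite !rblocks_mull; have [y [a [yX ->]]] := rblocks_startX ws w'_gt0.
rewrite rword_cons2 /h Hseq_rword; apply: Phi_peak => //; exact: is_word_rword.
Qed.

(** Once its first inner block is evaluated, [w0 x w1 X ...] becomes
    [w0 (x h1 X) ...], again an initial block times a word in [X]; so the inner
    blocks are evaluated from left to right until only the last one is left. *)
Lemma Phi_rblocks w0 x w ws : is_word S X x ->
  (0 < size w0)%N -> all (leq 1 \o size) (w :: ws) ->
  Phi (rblocks (lblock w0 x) (w :: ws)) =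
  Phi (rword S X (lact S (h w0) x) [seq h v | v <- w :: ws]).
Proof.
move=> xX w0_gt0; elim: ws w x xX => [|w' ws IHws] w x xX.
  rewrite [all _ _]/= andbT => w_gt0.
  by rewrite -[rblocks _ _]/(rword S Y _ w) Phi_outer_blocks // -Phi_lract.
move=> /andP[w_gt0 ws_gt0]; have /andP[w'_gt0 _] := ws_gt0.
rewrite -[rblocks _ _]/(rblocks (rword S Y (lblock w0 x) w * X)%g (w' :: ws)).
rewrite Phi_inner_block // -lblock_ract -lblock_mul IHws //.
  by rewrite -lact_mul lact_ract.
by apply/is_word_mul/is_wordX/is_word_ract.
Qed.

(** The first letter is treated apart because nothing in [A] precedes the
    first block: it is either the scalar [b], followed by [X], or starts with
    [b Y]. *)
Lemma Hseq_addE b s :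
  Hseq S Phi (X + Y) (b :: s) =
  \sum_(c <- compositions (size s))
    Hseq S Phi X [seq Hseq S Phi Y w | w <- reshape c (b :: s)].
Proof.
case: s => [|b' s]; first by rewrite big_seq1.
rewrite Hseq_rword lactD rwordD -!rblocks_sum linearD !linear_sum.
rewrite [compositions (size (b' :: s))]/= big_cat !big_map.
congr (_ + _); apply: eq_big_seq => c c_comp;
  have := reshape_compositions_nonnil (s := b' :: s) c_comp erefl;
  move: c_comp; rewrite mem_compositions; case: c => [|[|m] t] // _.
- rewrite -[reshape (1 :: _)%N _]/([:: b] :: reshape (m.+1 :: t) (b' :: s)).
  move: (reshape _ _) (isT : (0 < size (reshape (m.+1 :: t) (b' :: s)))%N).
  case=> // w ws _ ws_gt0; rewrite !map_cons Hseq_rword -map_cons.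
  by rewrite -[lact S b X]/(lblock [:: b] X) Phi_rblocks //; apply: is_wordX.
rewrite -[reshape (incr_head _) _]/
  ((b :: b' :: take m s) :: reshape t (drop m s)).
rewrite -[reshape _ _]/((b' :: take m s) :: reshape t (drop m s)).
case: (reshape t _) => [|w ws] ws_gt0; first by rewrite /= -Hseq_rword.
rewrite !map_cons Hseq_rword.
exact: (@Phi_rblocks [:: b, b' & take m s] X w ws (is_wordX S X) isT).
Qed.

End Blocks.

(* The index set is [bool], ordered by false < true. *)
Theorem theorem3p7 (K : fieldType) (B A : nuAlgType K) (S : balgebra B A)
    (Phi : {linear A -> B}) (Phi_lin : B_linear S Phi) (X Y : A)
    (XY_indep : mon_indep_elements S Phi (fun j : bool => if j then Y else X)) :
  Hser S Phi (X + Y) = mfs_comp (Hser S Phi X) (Hser S Phi Y).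
Proof.
apply: mfs_eq => // n b.
rewrite [RHS](@mfs_compS_compositions _ _ _ _ (Hseq S Phi X) (Hseq S Phi Y)) //.
rewrite /= /HS; have := size_codom b; rewrite card_ord.
by case: (codom b) => // b0 s [<-]; apply: Hseq_addE.
Qed.
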